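(* Let $(C,\phi)$ be an $n$-component semicoherent system whose component lifetimes $T_1,\ldots,T_n$ may be dependent but have no ties, i.e. $\Pr(T_i=T_j)=0$ whenever $i\neq j$. Let $p_k$, $\overline{P}_k$, $\psi$, $g(\mathbf{x})$, $g(x)$, $c(A)$, $\psi_k$, $c_k$ be the associated quantities defined in the context. Then the following all hold (polynomial identities being in the variable $x$, or $\mathbf{x}=(x_1,\ldots,x_n)$). (a) $\overline{P}_k=\sum_{i=k+1}^n p_i$ for $k=0,\ldots,n$, and $p_k=\overline{P}_{k-1}-\overline{P}_k$ for $k=1,\ldots,n$. (b) For $k=1,\ldots,n$, $$p_k=\sum_{A\subseteq C,\,|A|=n-k+1}\frac{1}{\binom{n}{|A|}}\psi(A)-\sum_{A\subseteq C,\,|A|=n-k}\frac{1}{\binom{n}{|A|}}\psi(A).$$ (c) $$g(\mathbf{x})=\sum_{A\subseteq C}\psi(A)\prod_{i\in A}x_i\prod_{i\in C\setminus A}(1-x_i)=\sum_{A\subseteq C}c(A)\prod_{i\in A}x_i,$$ $$g(x)=\sum_{k=0}^n\psi_k\,x^k(1-x)^{n-k}=\sum_{k=0}^nc_k\,x^k,$$ where $\psi_k=\sum_{|A|=k}\psi(A)$ and $c_k=\sum_{|A|=k}c(A)$ for $k=0,\ldots,n$. (d) For every $A\subseteq C$, $\psi(A)=\sum_{B\subseteq A}c(B)$ and $c(A)=\sum_{B\subseteq A}(-1)^{|A|-|B|}\psi(B)$. (e) For $k=1,\ldots,n$, $$\psi_k=\sum_{j=0}^k\binom{n-j}{k-j}c_j,\qquad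 c_k=\sum_{j=0}^k(-1)^{k-j}\binom{n-j}{k-j}\psi_j.$$ (f) $$\sum_{k=1}^np_k\,x^k=1+(x-1)\sum_{k=0}^n\overline{P}_k\,x^k.$$ (g) For $k=0,\ldots,n$, $$\overline{P}_k=\frac{1}{\binom{n}{k}}\sum_{A\subseteq C,\,|A|=n-k}\psi(A)=\frac{1}{\binom{n}{k}}\psi_{n-k}.$$ (h) For $k=0,\ldots,n$, $$\overline{P}_k=\sum_{j=0}^{n-k}\frac{\binom{n-j}{k}}{\binom{n}{k}}c_j=\sum_{j=0}^{n-k}\frac{\binom{n-k}{j}}{\binom{n}{j}}c_j,\qquad c_k=\binom{n}{k}\sum_{j=0}^k(-1)^{k-j}\binom{k}{j}\overline{P}_{n-j},$$ and for $k=1,\ldots,n$, $c_k=\binom{n}{k}\big(\Delta_i^k\,\overline{P}_{n-i}\big)\big|_{i=0}$; here, for any sequence $z_i$, $\Delta_i^kz_i=\sum_{j=0}^k(-1)^{k-j}\binom{k}{j}z_{i+j}$. (i) For $k=1,\ldots,n$, $$p_k=\sum_{j=0}^{n-k}\frac{\binom{n-j}{k}}{\binom{n}{k}}\,\frac{j+1}{n-j}\,c_{j+1}=\sum_{j=1}^{n-k+1}\frac{\binom{n-k}{j-1}}{\binom{n}{j}}\,c_j,$$ $$c_k=\binom{n}{k}\sum_{j=0}^{k-1}(-1)^{k-1-j}\binom{k-1}{j}p_{n-j}=\binom{n}{k}\big(\Delta_i^{k-1}\,p_{n-i}\big)\big|_{i=0}.$$ (j) $$g(x)=\sum_{k=0}^n\overline{P}_{n-k}\binom{n}{k}x^k(1-x)^{n-k},\qquad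 (R^ng)(x+1)=\sum_{k=0}^n\binom{n}{k}\overline{P}_k\,x^k,$$ and $\binom{n}{k}\overline{P}_k=[x^k](R^ng)(x+1)$ for $k=0,\ldots,n$. (k) $k\binom{n}{k}p_k=[x^{k-1}](R^{n-1}g')(x+1)$ for $k=1,\ldots,n$, and $$\sum_{k=1}^n\binom{n}{k}p_k\,k\,x^{k-1}=(R^{n-1}g')(x+1),\qquad \sum_{k=1}^n\binom{n}{k}p_k\,x^k=\int_0^x(R^{n-1}g')(t+1)\,dt.$$ (l) $$\sum_{k=0}^n\overline{P}_k\,x^k=\int_0^1(n+1)\,R^n_t\big((R^ng)((t-1)x+1)\big)\,dt,\qquad \sum_{k=1}^np_k\,x^k=\int_0^1x\,R^{n-1}_t\big((R^{n-1}g')((t-1)x+1)\big)\,dt;$$ here $\int_0^1t^{n-k}(1-t)^k\,dt=\frac{1}{(n+1)\binom{n}{k}}$ for $k=0,\ldots,n$. (m) $$g'(x)=\sum_{k=1}^np_k\,k\binom{n}{k}x^{n-k}(1-x)^{k-1},$$ $$g(x)=\sum_{k=1}^np_k\,I_x(n-k+1,k)=\sum_{k=1}^np_k\sum_{i=n-k+1}^n\binom{n}{i}x^i(1-x)^{n-i}.$$ (n) $$g(x)=\big((x\Delta_i+I)^n\,\overline{P}_{n-i}\big)\big|_{i=0},\qquad g'(x)=n\big((x\Delta_i+I)^{n-1}\,p_{n-i}\big)\big|_{i=0}.$$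
   Context: $n\ge1$, $C=[n]=\{1,\ldots,n\}$ is the set of components, and $\phi\colon\{0,1\}^n\to\{0,1\}$ is the structure function. The system is semicoherent: $\phi$ is nondecreasing in each variable, $\phi(0,\ldots,0)=0$ and $\phi(1,\ldots,1)=1$. Boolean vectors $\mathbf{x}\in\{0,1\}^n$ are identified with subsets $A\subseteq C$ by $x_i=1$ iff $i\in A$, and the same symbol is used for a function on $\{0,1\}^n$ and the corresponding set function. A path set is a subset $A\subseteq C$ with $\phi(A)=1$. $T_{k:n}$ is the $k$-th smallest of the component lifetimes $T_1,\ldots,T_n$, and $T_S$ is the system lifetime, i.e. the time at which the system fails, $T_S=\max_{A:\phi(A)=1}\min_{i\in A}T_i$. The probability signature is $(p_1,\ldots,p_n)$ with $p_k=\Pr(T_S=T_{k:n})$, and $\overline{P}_k=\sum_{i=k+1}^np_i$ for $k=0,\ldots,n$. The relative quality function is $q(A)=\Pr\big(\max_{i\notin A}T_i<\min_{i\in A}T_i\big)$ for $A\subseteq C$ (with $q(\varnothing)=q(C)=1$). The $q$-structure function $\psi\colon2^{[n]}\to\mathbb{R}$ is defined by $\psi(A)=\binom{n}{|A|}q(A)\phi(A)$, i.e. $\psi(A)=\binom{n}{|A|}q(A)$ if $A$ is a path set and $\psi(A)=0$ otherwise. Its multilinear extension is $g\colon[0,1]^n\to\mathbb{R}$, $g(\mathbf{x})=\sum_{A\subseteq C}\psi(A)\prod_{i\in A}x_i\prod_{i\in C\setminus A}(1-x_i)$, and $c(A)$ denotes the coefficients of its unique standard multilinear form $g(\mathbf{x})=\sum_{A\subseteq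 C}c(A)\prod_{i\in A}x_i$. The diagonal section is the univariate polynomial $g(x)=g(x,\ldots,x)$, with derivative $g'(x)$. For $k=0,\ldots,n$, $\psi_k=\sum_{|A|=k}\psi(A)$ and $c_k=\sum_{|A|=k}c(A)$. $\Delta_i$ is the difference operator acting on sequences indexed by $i$: $\Delta_iz_i=z_{i+1}-z_i$, $\Delta_i^0z_i=z_i$, $\Delta_i^kz_i=\Delta_i\Delta_i^{k-1}z_i$; $I$ is the identity operator, $x\Delta_i+I$ maps $z_i$ to $x(z_{i+1}-z_i)+z_i$ for a scalar $x$, and powers denote iteration. These are applied to $\overline{P}_{n-i}$ ($i=0,\ldots,n$) and $p_{n-i}$ ($i=0,\ldots,n-1$). For a univariate polynomial $f(x)=a_mx^m+\cdots+a_0$ of degree at most $m$, the $m$-reflected polynomial is $(R^mf)(x)=a_0x^m+a_1x^{m-1}+\cdots+a_m$, i.e. $x^mf(1/x)$; $R^m_t$ is the $m$-reflection with respect to the variable $t$, i.e. $(R^m_tF)(t,x)=t^mF(1/t,x)$. $(R^mf)(y)$ denotes $R^mf$ evaluated at $y$. $[x^k]f(x)$ is the coefficient of $x^k$ in $f(x)$. For $a,b,x>0$, $I_x(a,b)=\int_0^xt^{a-1}(1-t)^{b-1}\,dt\big/\int_0^1t^{a-1}(1-t)^{b-1}\,dt$ is the regularized beta function. *)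

(* Defs.v *)
From HB Require Import structures.
From mathcomp Require Import all_boot all_order all_algebra.
From mathcomp Require Import all_classical all_reals all_analysis.
(* The notations of mpoly are incompatible with those of analysis. *)
From mathcomp Require Import -(notations) mpoly.

Set Implicit Arguments.
Unset Strict Implicit.
Unset Printing Implicit Defensive.

Import Order.TTheory GRing.Theory Num.Theory.
Import numFieldNormedType.Exports.

Local Open Scope classical_set_scope.
Local Open Scope ring_scope.

Section StructureFunction.
Variable n : nat.

Definition bvec (A : {set 'I_n}) : {ffun 'I_n -> bool} :=
  [ffun i => i \in A].

Definition set_fun U (f : {ffun 'I_n -> bool} -> U) (A : {set 'I_n}) : U :=
  f (bvec A).

Definition nondecreasing_in_each (phi : {ffun 'I_n -> bool} -> bool) : Prop :=
  forall (i : 'I_n) (x y : {ffun 'I_n -> bool}),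
    (forall j, j != i -> x j = y j) -> (x i <= y i)%N -> (phi x <= phi y)%N.

Definition semicoherent (phi : {ffun 'I_n -> bool} -> bool) : Prop :=
  [/\ nondecreasing_in_each phi,
      phi [ffun=> false] = false &
      phi [ffun=> true] = true].

Definition path_set (phi : {ffun 'I_n -> bool} -> bool) (A : {set 'I_n}) : bool :=
  set_fun phi A.

End StructureFunction.

Section Lifetimes.
Context {R : realType} {d : measure_display} {Omega : measurableType d}.
Variables (P : probability Omega R) (n : nat).
Variables (T : 'I_n -> {RV P >-> R}).

Definition no_ties : Prop :=
  forall i j : 'I_n, i != j -> P [set w | T i w = T j w] = 0%E.

(* T_{k:n}, with k counted from 1; only used for 1 <= k <= n. *)
Definition order_stat (k : nat) (w : Omega) : R :=
  nth 0 (sort <=%R [seq T i w | i <- enum 'I_n]) k.-1.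

(* Maxima and minima of lifetimes are taken in \bar R, so that an empty     *)
(* maximum is -oo and an empty minimum is +oo.                              *)
Definition max_lifetime (A : {set 'I_n}) (w : Omega) : \bar R :=
  \big[maxe/-oo%E]_(i in A) (T i w)%:E.

Definition min_lifetime (A : {set 'I_n}) (w : Omega) : \bar R :=
  \big[mine/+oo%E]_(i in A) (T i w)%:E.

(* q; the conventions for max and min above give q(set0) = q(setT) = 1.     *)
Definition rel_quality (A : {set 'I_n}) : R :=
  fine (P [set w | (max_lifetime (~: A) w < min_lifetime A w)%E]).

Variable phi : {ffun 'I_n -> bool} -> bool.

Definition system_lifetime (w : Omega) : \bar R :=
  \big[maxe/-oo%E]_(A : {set 'I_n} | path_set phi A) min_lifetime A w.

Definition prob_signature (k : nat) : R :=
  fine (P [set w | system_lifetime w = (order_stat k w)%:E]).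

Definition tail_signature (k : nat) : R :=
  \sum_(k.+1 <= i < n.+1) prob_signature i.

Definition q_structure (A : {set 'I_n}) : R :=
  'C(n, #|A|)%:R * rel_quality A * (set_fun phi A)%:R.

End Lifetimes.

Section MultilinearExtension.
Variables (R : realType) (n : nat).

Definition mvar (i : 'I_n) : mpoly n R := mpolyX R (mnm1 i).

Definition multilinear_ext (v : {set 'I_n} -> R) : mpoly n R :=
  \sum_(A : {set 'I_n})
    v A *: ((\prod_(i in A) mvar i) * \prod_(i in ~: A) (1 - mvar i)).

(* mesym1 A is the exponent vector of \prod_(i in A) x_i. *)
Definition multilinear_coef (G : mpoly n R) (A : {set 'I_n}) : R :=
  mcoeff (mesym1 A) G.

Definition diag_section (G : mpoly n R) : {poly R} :=
  mmap polyC (fun=> 'X) G.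

Definition level_sum (v : {set 'I_n} -> R) (k : nat) : R :=
  \sum_(A : {set 'I_n} | #|A| == k) v A.

End MultilinearExtension.

(* R^m f, meant for f of degree at most m, i.e. size f <= m.+1. *)
Definition reflect_poly (K : nzRingType) (m : nat) (f : {poly K}) : {poly K} :=
  \sum_(0 <= i < m.+1) f`_i *: 'X^(m - i).

(* f((t - 1) x + 1) in R[x][t]: the outer 'X is t, and the constant 'X%:P   *)
(* is x.  Thus reflect_poly applied to it is the reflection in t.           *)
Definition subst_tx (K : nzRingType) (f : {poly K}) : {poly {poly K}} :=
  map_poly polyC f \Po (('X - 1) * ('X)%:P + 1).

Definition eval_tx (K : nzRingType) (F : {poly {poly K}}) (t x : K) : K :=
  F.[t%:P].[x].

Section Difference.
Variable K : nzRingType.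

Definition diff_op (z : nat -> K) : nat -> K := fun i => z i.+1 - z i.

(* x Delta + I *)
Definition xdiff_op (x : K) (z : nat -> K) : nat -> K :=
  fun i => x * diff_op z i + z i.

End Difference.

Section Integrals.
Variable R : realType.

Definition oriented_integral (a b : R) (f : R -> R) : R :=
  if a <= b then (\int[@lebesgue_measure R]_(t in `[a, b]) f t)%R
  else - (\int[@lebesgue_measure R]_(t in `[b, a]) f t)%R.

(* I_x(a, b) for positive integers a and b, the only ones needed. *)
Definition reg_beta (x : R) (a b : nat) : R :=
  oriented_integral 0 x (fun t => t ^+ a.-1 * (1 - t) ^+ b.-1)
  / oriented_integral 0 1 (fun t => t ^+ a.-1 * (1 - t) ^+ b.-1).

End Integrals.

(* Main.v *)
Require Import Defs.
From HB Require Import structures.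
From mathcomp Require Import all_boot all_order all_algebra.
From mathcomp Require Import all_classical all_reals all_analysis.
From mathcomp Require Import -(notations) mpoly.
From mathcomp Require Import ring zify.

Set Implicit Arguments.
Unset Strict Implicit.
Unset Printing Implicit Defensive.

Import Order.TTheory GRing.Theory Num.Theory.
Import numFieldNormedType.Exports.

Local Open Scope classical_set_scope.
Local Open Scope ring_scope.

(** The probability signature is the increment of one finite sequence, and each
    displayed formula is a change of basis for that sequence.

    Probabilistic part.  Every event involved depends only on the order pattern
    of the lifetimes, i.e. on the finite boolean matrix of the comparisons
    [T i <= T j].  Almost surely there are no ties, and then for each size
    there is exactly one set [A] of that size whose components all outlive the
    others: these sets are the survivors at the successive failure times.  The
    system fails at the [k]-th component failure exactly when the [n - k + 1]
    survivors just before it form a path set and the [n - k] survivors just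
    after it do not.  Monotonicity of [phi] turns the probability of this event
    into a difference ([prob_signature_psi]), and telescoping, with the empty
    set not being a path set, gives
    [Pbar k = psi_ (n - k) / 'C(n, k)] ([tail_signature_psi]).

    Multilinear part.  Expanding the products of the [1 - x_i] identifies the
    coefficients of the extension as the Moebius transform of [psi]
    ([multilinear_extE]); evaluation at indicator vectors inverts it
    ([sum_multilinear_coef]).  Hence the diagonal section has
    the coefficients [c_ k] in the monomial basis and
    [psi_ k = 'C(n, k) Pbar (n - k)] in the Bernstein basis.

    Univariate part.  Let [z i = Pbar (n - i)].  A binomial theorem for the
    operators [a D + b], where [D] is linear ([iter_affine]), applied to the
    shift and to the difference operator, yields both the Bernstein form and the
    Newton form of [(x Delta + I)^n z]; hence
    [c_ k = 'C(n, k) (Delta^k z) 0] ([c_diff]).  The relations between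
    [psi_], [c_], [Pbar] and [p] are this formula, its inversion, and
    [p (n - i) = z (i + 1) - z i].  Reflection maps
    ['X^i (1 - 'X)^k], of degree [i + k], to [('X - 1)^k], which is the source of
    the formulas with [R^n g] and [R^(n-1) g'].  Finally the tails of the
    Bernstein basis have a multiple of ['X^(n-k) (1 - 'X)^(k-1)] as derivative
    ([deriv_bernstein_tail]): they are antiderivatives of the beta integrands, so
    all integrals reduce to evaluating polynomials, and summation by parts
    expresses [g] through the incomplete beta functions. *)

(** * Iterated affine operators on sequences *)

(** The binomial theorem for the commuting operators [a D] and [b I], where [D]
    is linear.  Taking [D] to be the shift or the difference operator gives all
    the expansions of iterated operators below. *)
Lemma iter_affine (K : comNzRingType) (D : (nat -> K) -> nat -> K) (a b : K) :
  (forall c e y z i, D (fun j => c * y j + e * z j) i = c * D y i + e * D z i) ->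
  forall m z i,
  iter m (fun z i => a * D z i + b * z i) z i
    = \sum_(0 <= k < m.+1) 'C(m, k)%:R * (a ^+ k * b ^+ (m - k)) * iter k D z i.
Proof.
move=> linD; have linDk k : forall c e y z i,
    iter k D (fun j => c * y j + e * z j) i = c * iter k D y i + e * iter k D z i.
  elim: k => [//|k IH] c e y z i; rewrite !iterSr -IH; congr (iter k D _ i).
  by apply/funext => j; rewrite linD.
elim=> [|m IH] z i; first by rewrite big_nat1 bin0 !expr0 !mulr1 mul1r.
rewrite iterSr IH.
under eq_bigr do rewrite linDk -iterSr mulrDr.
rewrite big_split /= [X in _ + X = _]big_nat_recl// [RHS]big_nat_recl//= !bin0.
under [in RHS]eq_bigr do rewrite binS natrD !mulrDl.
rewrite big_split/= [X in _ = _ + (X + _)]big_nat_recr//= bin_small// !mul0r addr0.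
rewrite addrCA; congr (_ + _); first by rewrite !subn0 exprS !expr0; ring.
rewrite addrC; congr (_ + _); last first.
  by apply: eq_bigr => k _; rewrite subSS exprS; ring.
rewrite !big_nat; apply: eq_bigr => k /andP[_ km].
by rewrite subSS -(subnSK km) [b ^+ _.+1]exprS; ring.
Qed.

Definition shift_op (K : nzRingType) (z : nat -> K) : nat -> K := fun i => z i.+1.

Lemma iter_shift (K : nzRingType) (z : nat -> K) k i :
  iter k (@shift_op K) z i = z (i + k)%N.
Proof. by elim: k z => [|k IH] z; rewrite ?addn0// iterSr IH addnS. Qed.

Lemma diff_linear (K : comNzRingType) (c e : K) y z i :
  diff_op (fun j => c * y j + e * z j) i = c * diff_op y i + e * diff_op z i.
Proof. by rewrite /diff_op; ring. Qed.

Lemma iter_diff (K : comNzRingType) (z : nat -> K) k i :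
  iter k (@diff_op K) z i
    = \sum_(0 <= j < k.+1) (-1) ^+ (k - j) * 'C(k, j)%:R * z (i + j)%N.
Proof.
have -> : @diff_op K = fun z i => 1 * shift_op z i + (-1) * z i.
  by do 2!apply/funext => ?; rewrite /diff_op /shift_op; ring.
rewrite iter_affine//; apply: eq_bigr => j _.
by rewrite iter_shift expr1n; ring.
Qed.

(** [x Delta + I = x E + (1 - x) I], where [E] is the shift. *)
Lemma iter_xdiff_bernstein (K : comNzRingType) (x : K) (z : nat -> K) m i :
  iter m (xdiff_op x) z i
    = \sum_(0 <= k < m.+1) 'C(m, k)%:R * (x ^+ k * (1 - x) ^+ (m - k)) * z (i + k)%N.
Proof.
have -> : xdiff_op x = fun z i => x * shift_op z i + (1 - x) * z i.
  by do 2!apply/funext => ?; rewrite /xdiff_op /diff_op /shift_op; ring.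
by rewrite iter_affine//; apply: eq_bigr => j _; rewrite iter_shift.
Qed.

Lemma iter_xdiff_newton (K : comNzRingType) (x : K) (z : nat -> K) m i :
  iter m (xdiff_op x) z i
    = \sum_(0 <= k < m.+1) 'C(m, k)%:R * x ^+ k * iter k (@diff_op K) z i.
Proof.
have -> : xdiff_op x = fun z i => x * diff_op z i + 1 * z i.
  by do 2!apply/funext => ?; rewrite /xdiff_op; ring.
rewrite iter_affine; last exact: diff_linear.
by apply: eq_bigr => j _; rewrite expr1n mulr1.
Qed.

(** Newton's forward difference formula: [E = Delta + I]. *)
Lemma newton_forward (K : comNzRingType) (z : nat -> K) m :
  z m = \sum_(0 <= k < m.+1) 'C(m, k)%:R * iter k (@diff_op K) z 0%N.
Proof.
transitivity (iter m (xdiff_op 1) z 0%N); last first.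
  by rewrite iter_xdiff_newton; apply: eq_bigr => k _; rewrite expr1n mulr1.
have -> : xdiff_op 1 = @shift_op K.
  by do 2!apply/funext => ?; rewrite /xdiff_op /diff_op /shift_op; ring.
by rewrite iter_shift.
Qed.

Lemma iter_diff_polyC (R : comNzRingType) (z : nat -> R) k i :
  iter k (@diff_op {poly R}) (fun j => (z j)%:P) i = (iter k (@diff_op R) z i)%:P.
Proof.
elim: k i => [//|k IH] i; rewrite !iterS {1}/diff_op !IH -polyCB//.
Qed.

(** Both sides are [(x Delta + I)^n z] at [0], for [x] the indeterminate: this is
    why the iterated operators are studied over an arbitrary commutative ring. *)
Lemma bernstein_to_monomial (R : comNzRingType) (z : nat -> R) n :
  \sum_(0 <= k < n.+1) ('C(n, k)%:R * z k) *: ('X^k * (1 - 'X) ^+ (n - k))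
    = \sum_(0 <= k < n.+1) ('C(n, k)%:R * iter k (@diff_op R) z 0%N) *: 'X^k.
Proof.
transitivity (iter n (xdiff_op 'X) (fun j => (z j)%:P) 0%N).
  rewrite iter_xdiff_bernstein; apply: eq_bigr => k _.
  by rewrite -mul_polyC polyCM polyC_natr add0n; ring.
rewrite iter_xdiff_newton; apply: eq_bigr => k _.
by rewrite iter_diff_polyC -mul_polyC polyCM polyC_natr; ring.
Qed.

Lemma eq_iter_diff (K : comNzRingType) (y z : nat -> K) k i :
  (forall j, (j <= k)%N -> y (i + j)%N = z (i + j)%N) ->
  iter k (@diff_op K) y i = iter k (@diff_op K) z i.
Proof.
move=> yz; rewrite !iter_diff !big_nat; apply: eq_bigr => j /andP[_ jk].
by rewrite yz.
Qed.

(** * Reflected polynomials *)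

Lemma reflect_poly_is_linear (K : nzRingType) m : linear (@reflect_poly K m).
Proof.
move=> a f h; rewrite /reflect_poly scaler_sumr -big_split/=.
by apply: eq_bigr => i _; rewrite coefD coefZ scalerDl scalerA.
Qed.

HB.instance Definition _ (K : nzRingType) m :=
  GRing.isLinear.Build K {poly K} {poly K} _ (@reflect_poly K m)
    (reflect_poly_is_linear m).

Lemma reflect_polyXn (K : nzRingType) m i : (i <= m)%N ->
  reflect_poly m 'X^i = 'X^(m - i) :> {poly K}.
Proof.
move=> im; rewrite /reflect_poly (bigD1_seq i) ?mem_index_iota ?iota_uniq//=.
rewrite coefXn eqxx scale1r big1 ?addr0// => j ji.
by rewrite coefXn (negPf ji) scale0r.
Qed.

(** The reflection exchanges the two coefficients of an affine factor.  The
    coefficients [b] and [c] range over any ring, so that the lemma also covers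
    reflection in one of two variables. *)
Lemma reflect_poly_affine (K : comNzRingType) m i k (b c : K) : (i + k <= m)%N ->
  reflect_poly m ('X^i * (b%:P * 'X + c%:P) ^+ k)
    = 'X^(m - (i + k)) * (b%:P + c%:P * 'X) ^+ k.
Proof.
move=> ikm; rewrite !exprDn !mulr_sumr linear_sum/=; apply: eq_bigr => -[j/= jk] _.
rewrite ltnS in jk.
have -> : 'X^i * ((b%:P * 'X) ^+ (k - j) * c%:P ^+ j *+ 'C(k, j))
    = (b ^+ (k - j) * c ^+ j * 'C(k, j)%:R) *: 'X^(i + (k - j)).
  by rewrite -mul_polyC !polyCM polyC_natr !polyC_exp exprD exprMn; ring.
rewrite linearZ/= reflect_polyXn; last by lia.
have -> : (m - (i + (k - j)) = m - (i + k) + j)%N by lia.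
by rewrite -mul_polyC !polyCM polyC_natr !polyC_exp exprD exprMn; ring.
Qed.

(** Reflection and the translation by 1 turn the Bernstein basis into the
    monomial basis. *)
Lemma reflect_bernstein_shift (K : comNzRingType) m i k : (i + k = m)%N ->
  reflect_poly m ('X^i * (1 - 'X) ^+ k) \Po ('X + 1) = 'X^k :> {poly K}.
Proof.
move=> ikm; have -> : 1 - 'X = (-1)%:P * 'X + 1%:P :> {poly K}.
  by rewrite polyCN polyC1; ring.
rewrite reflect_poly_affine ikm// subnn expr0 mul1r rmorphXn/=.
by rewrite comp_polyD comp_polyM comp_polyX !comp_polyC polyCN polyC1; congr (_ ^+ k); ring.
Qed.

Lemma reflect_shift_sum (K : comNzRingType) m (r : seq nat) (a : nat -> K) F :
  reflect_poly m (\sum_(i <- r) a i *: F i) \Po ('X + 1)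
    = \sum_(i <- r) a i *: (reflect_poly m (F i) \Po ('X + 1)).
Proof.
elim: r => [|i r IH]; first by rewrite !big_nil linear0 comp_poly0.
by rewrite !big_cons linearP/= comp_polyD comp_polyZ IH.
Qed.

(** The substitution sends ['X^k] in the shifted variable to [((t - 1) x)^k], whose
    reflection in [t] is [x^k] times the beta integrand. *)
Lemma eval_reflect_subst (K : comNzRingType) m (f : {poly K}) (b : nat -> K) t x :
  f \Po ('X + 1) = \sum_(0 <= k < m.+1) b k *: 'X^k ->
  eval_tx (reflect_poly m (subst_tx f)) t x
    = \sum_(0 <= k < m.+1) b k * x ^+ k * (t ^+ (m - k) * (1 - t) ^+ k).
Proof.
move=> fb.
have -> : subst_tx f = map_poly polyC (f \Po ('X + 1)) \Po (('X - 1) * 'X%:P).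
  rewrite /subst_tx map_comp_poly -comp_polyA; congr (_ \Po _).
  by rewrite rmorphD/= map_polyX rmorph1 comp_polyD comp_polyX comp_polyC.
rewrite fb rmorph_sum/= raddf_sum/= linear_sum/= /eval_tx.
rewrite !horner_sum !big_nat; apply: eq_bigr => k /andP[_ km].
rewrite map_polyZ/= map_polyXn comp_polyZ comp_Xn_poly.
have -> : (('X - 1) * 'X%:P) ^+ k = ('X^k : {poly K}) *: ('X^0 * (1%:P * 'X + (-1)%:P) ^+ k).
  by rewrite polyC1 polyCN mul1r expr0 mul1r exprMn -mul_polyC polyC_exp mulrC.
rewrite !linearZ/= reflect_poly_affine// !hornerE/=.
by rewrite mulN1r.
Qed.

(** * Integrals of Bernstein polynomials *)

(** The derivative of the [i]-th Bernstein term is a difference [e (i-1) - e i],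
    so the sum telescopes to its first term; [e n] vanishes. *)
Lemma deriv_bernstein_tail (K : comNzRingType) n k : (0 < k <= n)%N ->
  (\sum_(n - k + 1 <= i < n.+1)
     'C(n, i)%:R *: ('X^i * (1 - 'X) ^+ (n - i)) : {poly K})^`()
    = (k%:R * 'C(n, k)%:R) *: ('X^(n - k) * (1 - 'X) ^+ k.-1).
Proof.
move=> /andP[k0 kn]; rewrite raddf_sum/=.
pose e i : {poly K} := ((n - i) * 'C(n, i))%:R *: ('X^i * (1 - 'X) ^+ (n - i).-1).
rewrite addn1 big_add1/=.
transitivity (\sum_(n - k <= i < n) (- e i.+1 - - e i)).
  rewrite !big_nat; apply: eq_bigr => i /andP[_ lin].
  rewrite derivZ derivM derivXn deriv_exp derivB -polyC1 derivC derivX /=.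
  rewrite /e -!mul_polyC !polyC_natr -mulr_natr -[in X in _ + X]mulr_natr.
  by rewrite -(mul_bin_left n i) polyC1 !natrM -?subnS; ring.
rewrite telescope_sumr ?leq_subr// /e subnn mul0n scale0r oppr0 sub0r opprK.
by rewrite subKn// bin_sub// natrM.
Qed.

Lemma oriented_integral_horner (R : realType) (F : {poly R}) (a b : R) :
  oriented_integral a b (fun t => F^`().[t]) = F.[b] - F.[a].
Proof.
have FTC x y : x < y ->
    (\int[@lebesgue_measure R]_(t in `[x, y]) F^`().[t])%R = F.[y] - F.[x].
  move=> xy; rewrite /Rintegral (@continuous_FTC2 _ _ (horner F))//.
  - exact/continuous_subspaceT/continuous_horner.
  - split=> [t _||]; first exact: derivable_horner.
    + by apply: cvg_at_right_filter; exact: continuous_horner.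
    + by apply: cvg_at_left_filter; exact: continuous_horner.
  - by move=> t _; rewrite derivE.
rewrite /oriented_integral; case: ltgtP => [ab|ba|->].
- exact: FTC.
- by rewrite FTC// opprB.
- by rewrite set_itv1 Rintegral_set1 subrr.
Qed.

Lemma beta_antiderivative (R : realType) n k : (0 < k <= n)%N ->
  exists2 F : {poly R}, F^`() = 'X^(n - k) * (1 - 'X) ^+ k.-1 &
    F = (k%:R * 'C(n, k)%:R)^-1 *: \sum_(n - k + 1 <= i < n.+1)
     'C(n, i)%:R *: ('X^i * (1 - 'X) ^+ (n - i)).
Proof.
move=> kn; eexists; last reflexivity.
rewrite derivZ deriv_bernstein_tail// scalerA mulVf ?scale1r//.
by rewrite -natrM pnatr_eq0 -lt0n muln_gt0 bin_gt0.
Qed.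

Lemma bernstein_tail0 (R : comNzRingType) n m : (0 < m)%N ->
  (\sum_(m <= i < n.+1) 'C(n, i)%:R *: ('X^i * (1 - 'X) ^+ (n - i)) : {poly R}).[0] = 0.
Proof.
move=> m0; rewrite horner_sum big_nat big1// => i /andP[mi _].
by rewrite hornerZ hornerM hornerXn expr0n gtn_eqF ?(leq_trans m0)// mul0r mulr0.
Qed.

Lemma bernstein_tail1 (R : comNzRingType) n m : (m <= n)%N ->
  (\sum_(m <= i < n.+1) 'C(n, i)%:R *: ('X^i * (1 - 'X) ^+ (n - i)) : {poly R}).[1] = 1.
Proof.
move=> mn; rewrite horner_sum big_nat_recr//= big_nat big1 ?add0r => [|i /andP[_ ilt]].
  by rewrite subnn binn !hornerE expr1n.
by rewrite !hornerE /= subrr expr0n subn_eq0 leqNgt ilt mulr0.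
Qed.

Lemma eq_oriented_integral (R : realType) (a b : R) f h : f =1 h ->
  oriented_integral a b f = oriented_integral a b h.
Proof. by move=> /funext ->. Qed.

(** The integrand has a tail of the Bernstein basis as antiderivative, up to a
    factor; that tail vanishes at 0. *)
Lemma beta_integral (R : realType) n k (x : R) : (0 < k <= n)%N ->
  oriented_integral 0 x (fun t : R => t ^+ (n - k) * (1 - t) ^+ k.-1)
  = (k%:R * 'C(n, k)%:R)^-1 *
    (\sum_(n - k + 1 <= i < n.+1) 'C(n, i)%:R *: ('X^i * (1 - 'X) ^+ (n - i)) : {poly R}).[x].
Proof.
move=> kn; have [F F' FE] := beta_antiderivative R kn.
rewrite (@eq_oriented_integral _ _ _ _ (fun t => F^`().[t])); last first.
  by move=> t; rewrite F' !hornerE.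
by rewrite oriented_integral_horner FE !hornerZ bernstein_tail0 ?addn1// mulr0 subr0.
Qed.

(** The tail equals 1 at 1, by the binomial formula for [x + (1 - x)]. *)
Lemma beta_integral01 (R : realType) n k : (k <= n)%N ->
  oriented_integral 0 1 (fun t : R => t ^+ (n - k) * (1 - t) ^+ k)
          = (n.+1%:R * 'C(n, k)%:R)^-1.
Proof.
move=> kn; have := @beta_integral R n.+1 k.+1 1.
rewrite subSS/= => ->//; rewrite bernstein_tail1; last by lia.
by rewrite mulr1 -!natrM mul_bin_diag.
Qed.

(** * Multilinear extensions *)

Lemma prod_mvarE (R : realType) n (A : {set 'I_n}) :
  \prod_(i in A) mvar R i = mpolyX R (mesym1 A).
Proof.
rewrite /mvar mprodXE; congr mpolyX.
apply/mnmP => i; rewrite mnmE mnm_sumE big_mkcond/=.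
rewrite (bigD1 i)//= mnmE eqxx big1 ?addn0 => [|j ji]; first by case: (i \in A).
by case: (j \in A); rewrite // mnmE (negPf ji).
Qed.

(** Inside [A] the factor is [x_i], outside it is [1 - x_i]; distributing the
    product over the choices of a summand in each factor leaves one monomial for
    each superset [B] of [A], with the sign of [B :\: A]. *)
Lemma multilinear_extE (R : realType) n (v : {set 'I_n} -> R) :
  multilinear_ext v = \sum_(B : {set 'I_n})
    (\sum_(A : {set 'I_n} | A \subset B) (-1) ^+ (#|B| - #|A|) * v A)
      *: \prod_(i in B) mvar R i.
Proof.
have expand (A : {set 'I_n}) : (\prod_(i in A) mvar R i) * \prod_(i in ~: A) (1 - mvar R i)
    = \sum_(B : {set 'I_n} | A \subset B)
        (-1) ^+ (#|B| - #|A|) *: \prod_(i in B) mvar R i.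
  transitivity (\prod_i ((if i \in A then mvar R i else - mvar R i)
                         + (if i \in A then 0 else 1))).
    rewrite [RHS](bigID (mem A))/=; congr (_ * _).
      by apply: eq_bigr => i ->; rewrite addr0.
    by apply: eq_big => i; rewrite ?inE// => /negPf ->; rewrite addrC.
  rewrite bigA_distr [RHS]big_mkcond/=; apply: eq_bigr => B _.
  case: ifPn => [AB|/fintype.subsetPn[i iA iB]]; last first.
    by rewrite (bigD1 i)//= (negPf iB) iA mul0r.
  rewrite (bigID (mem B))/= [X in _ * X]big1 ?mulr1; last first.
    move=> i iB; rewrite (negPf iB) ifF//; apply: contraNF iB.
    exact: (fintype.subsetP AB).
  rewrite (eq_bigr (fun i => (if i \in A then 1 else -1) * mvar R i)); last first.
    by move=> i ->; case: ifP; rewrite ?mul1r ?mulN1r.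
  rewrite big_split/= -mul_mpolyC; congr (_ * _).
  rewrite (big_setID A)/= big1 ?mul1r; last by move=> i; rewrite inE => /andP[_ ->].
  rewrite (eq_bigr (fun=> -1)); last by move=> i; rewrite inE => /andP[/negPf ->].
  by rewrite prodr_const cardsD (finset.setIidPr AB) rmorphXn/= rmorphN1.
rewrite /multilinear_ext; under eq_bigr do rewrite expand scaler_sumr.
rewrite (exchange_big_dep xpredT)//=; apply: eq_bigr => B _.
by rewrite scaler_suml; apply: eq_bigr => A _; rewrite scalerA mulrC.
Qed.

Lemma multilinear_coefE (R : realType) n (v : {set 'I_n} -> R) (A : {set 'I_n}) :
  multilinear_coef (multilinear_ext v) A
    = \sum_(B : {set 'I_n} | B \subset A) (-1) ^+ (#|A| - #|B|) * v B.
Proof.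
rewrite /multilinear_coef multilinear_extE raddf_sum (bigD1 A)//=.
rewrite [X in _ + X]big1 ?addr0; first last.
  move=> B BA; rewrite prod_mvarE mcoeffZ mcoeffX (inj_eq (@inj_mesym1 n)).
  by rewrite (negPf BA) mulr0.
by rewrite prod_mvarE mcoeffZ mcoeffX eqxx mulr1.
Qed.

Lemma multilinear_ext_monomial (R : realType) n (v : {set 'I_n} -> R) :
  multilinear_ext v = \sum_(A : {set 'I_n})
    multilinear_coef (multilinear_ext v) A *: \prod_(i in A) mvar R i.
Proof. by rewrite {1}multilinear_extE; apply: eq_bigr => A _; rewrite multilinear_coefE. Qed.

(** Evaluation at the indicator vector of [A] kills every term of the defining
    sum except the one of [A], and keeps the monomials of the subsets of [A]. *)
Lemma sum_multilinear_coef (R : realType) n (v : {set 'I_n} -> R) (A : {set 'I_n}) :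
  v A = \sum_(B : {set 'I_n} | B \subset A) multilinear_coef (multilinear_ext v) B.
Proof.
pose x (i : 'I_n) : R := (i \in A)%:R.
have evX (B : {set 'I_n}) : meval x (\prod_(i in B) mvar R i) = (B \subset A)%:R.
  rewrite rmorph_prod/=; under eq_bigr do rewrite /mvar mevalXU.
  case: fintype.subsetP => [BA|/fintype.subsetP/fintype.subsetPn[i iB iA]].
    by apply: big1 => i /BA; rewrite /x => ->.
  by rewrite (bigD1 i)//= /x (negPf iA) mul0r.
have evN (B : {set 'I_n}) : meval x (\prod_(i in ~: B) (1 - mvar R i)) = (A \subset B)%:R.
  rewrite rmorph_prod/=; under eq_bigr do rewrite rmorphB rmorph1 /mvar /= mevalXU.
  case: fintype.subsetP => [AB|/fintype.subsetP/fintype.subsetPn[i iA iB]].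
    apply: big1 => i; rewrite inE /x => iB.
    by rewrite (negPf (contra (AB i) iB)) subr0.
  by rewrite (bigD1 i) ?inE//= /x iA subrr mul0r.
transitivity (meval x (multilinear_ext v)).
  rewrite /multilinear_ext raddf_sum (bigD1 A)//= [X in _ + X]big1 ?addr0.
    by rewrite mevalZ rmorphM/= evX evN subxx !mulr1.
  move=> B BA; rewrite mevalZ rmorphM/= evX evN -natrM mulnb -finset.eqEsubset.
  by rewrite (negPf BA) mulr0.
rewrite {1}multilinear_ext_monomial raddf_sum [RHS]big_mkcond/=.
apply: eq_bigr => B _; rewrite mevalZ evX.
by case: ifP; rewrite ?mulr1 ?mulr0.
Qed.

Lemma sum_by_card (V : nmodType) (K : nzRingType) n (v : {set 'I_n} -> K) (f : nat -> K -> V) :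
 (forall k, {morph f k : x y / x + y}) -> (forall k, f k 0 = 0) ->
  \sum_(A : {set 'I_n}) f #|A| (v A)
    = \sum_(0 <= k < n.+1) f k (\sum_(A : {set 'I_n} | #|A| == k) v A).
Proof.
move=> fD f0.
have card_lt (A : {set 'I_n}) : (#|A| < n.+1)%N.
  by rewrite ltnS -[X in (_ <= X)%N](card_ord n) max_card.
rewrite (partition_big (fun A : {set 'I_n} => Ordinal (card_lt A)) xpredT)//= big_mkord.
apply: eq_bigr => k _; rewrite (big_morph _ (fD k) (f0 k)).
by apply: eq_big => [A|A /eqP/(congr1 val)/= <-].
Qed.

Lemma diag_section_psi (R : realType) n (v : {set 'I_n} -> R) :
  diag_section (multilinear_ext v)
    = \sum_(0 <= k < n.+1) level_sum v k *: ('X^k * (1 - 'X) ^+ (n - k)).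
Proof.
rewrite /level_sum -(sum_by_card v (f := fun k a => a *: ('X^k * (1 - 'X) ^+ (n - k)))).
- rewrite /diag_section /multilinear_ext raddf_sum; apply: eq_bigr => A _.
  rewrite /= mmapZ mul_polyC rmorphM !rmorph_prod/=; congr (_ *: (_ * _)).
    by under eq_bigr do rewrite /mvar mmapX mmap1U; rewrite prodr_const.
  under eq_bigr do rewrite rmorphB rmorph1 /mvar /= mmapX mmap1U.
  by rewrite prodr_const cardsCs finset.setCK card_ord.
- by move=> k x y; rewrite scalerDl.
- by move=> k; rewrite scale0r.
Qed.

Lemma diag_section_c (R : realType) n (v : {set 'I_n} -> R) :
  diag_section (multilinear_ext v)
    = \sum_(0 <= k < n.+1) level_sum (multilinear_coef (multilinear_ext v)) k *: 'X^k.
Proof.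
rewrite /level_sum -(sum_by_card _ (f := fun k a => a *: 'X^k)).
- rewrite {1}multilinear_ext_monomial /diag_section raddf_sum; apply: eq_bigr => A _.
  rewrite /= mmapZ mul_polyC rmorph_prod/=; congr (_ *: _).
  by under eq_bigr do rewrite /mvar mmapX mmap1U; rewrite prodr_const.
- by move=> k x y; rewrite scalerDl.
- by move=> k; rewrite scale0r.
Qed.

(** * Ratios of binomial coefficients *)

Lemma mul_bin_trinomial n j k : (j <= k <= n)%N ->
  ('C(n, k) * 'C(k, j) = 'C(n, j) * 'C(n - j, k - j))%N.
Proof.
move=> /andP[jk kn]; have jn := leq_trans jk kn.
have h1 := bin_fact kn; have h2 := bin_fact jk; have h3 := bin_fact jn.
have h4 := bin_fact (leq_sub2r j kn).
have e : (n - j - (k - j) = n - k)%N by lia.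
rewrite e in h4.
apply/eqP; rewrite -(eqn_pmul2r (_ : 0 < j`! * ((k - j)`! * (n - k)`!))%N); last first.
  by rewrite !muln_gt0 !fact_gt0.
apply/eqP; transitivity n`!; last by rewrite -h3 -h4; ring.
by rewrite -h1 -h2; ring.
Qed.

Lemma mul_bin_swap n j k : (j + k <= n)%N ->
  ('C(n, k) * 'C(n - k, j) = 'C(n, j) * 'C(n - j, k))%N.
Proof.
move=> jkn; have := @mul_bin_trinomial n k (j + k) _; have := @mul_bin_trinomial n j (j + k) _.
have -> : (j + k - k = j)%N by lia.
rewrite addKn => <-; last by lia.
move=> <-; last by lia.
by congr (_ * _)%N; rewrite -bin_sub ?leq_addl// addnK.
Qed.

Section Numeric.
Variable R : numFieldType.

Lemma bin_neq0 n k : (k <= n)%N -> 'C(n, k)%:R != 0 :> R.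
Proof. by move=> kn; rewrite pnatr_eq0 -lt0n bin_gt0. Qed.

Lemma bin_ratio_swap n j k : (j + k <= n)%N ->
  'C(n - j, k)%:R / 'C(n, k)%:R = 'C(n - k, j)%:R / 'C(n, j)%:R :> R.
Proof.
move=> jkn; have kn : (k <= n)%N by lia.
have jn : (j <= n)%N by lia.
apply/eqP; rewrite eqr_div ?bin_neq0// -!natrM.
by rewrite mulnC -(mul_bin_swap jkn) mulnC.
Qed.

Lemma bin_ratio_trinomial n j k : (j <= k <= n)%N ->
  'C(n, k)%:R * ('C(k, j)%:R / 'C(n, j)%:R) = 'C(n - j, k - j)%:R :> R.
Proof.
move=> jkn; have jn : (j <= n)%N by lia.
rewrite mulrA -natrM mul_bin_trinomial// natrM.
by rewrite mulrAC divff ?mul1r// bin_neq0.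
Qed.

Lemma bin_ratio_next n j k : (j + k <= n)%N -> (0 < k)%N ->
  'C(n - j, k)%:R / 'C(n, k)%:R * (j.+1%:R / (n - j)%:R)
    = 'C(n - k, j)%:R / 'C(n, j.+1)%:R :> R.
Proof.
move=> jkn k0; rewrite bin_ratio_swap//; have jn : (j < n)%N by lia.
have h : 'C(n, j.+1)%:R * j.+1%:R = (n - j)%:R * 'C(n, j)%:R :> R.
  by rewrite -!natrM mulnC mul_bin_left.
have c0 : 'C(n, j)%:R != 0 :> R by rewrite bin_neq0// ltnW.
have c1 : 'C(n, j.+1)%:R != 0 :> R by rewrite bin_neq0.
have nj : (n - j)%:R != 0 :> R by rewrite pnatr_eq0 subn_eq0 -ltnNge.
rewrite -mulrA; congr (_ * _).
apply: (mulfI c1); rewrite divff// mulrCA (mulrA 'C(n, j.+1)%:R) h.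
by field; rewrite c0 nj.
Qed.
End Numeric.

(** * Identities between the signature, its tails and the diagonal section *)

Lemma coef_sum_scaleX (K : nzRingType) n (c : nat -> K) k : (k <= n)%N ->
  (\sum_(0 <= j < n.+1) c j *: 'X^j)`_k = c k.
Proof.
by move=> kn; rewrite big_mkord -poly_def coef_poly ltnS kn.
Qed.

(** The beta integrands of degree [m] have tails of degree [m + 1] as
    antiderivatives, up to factors. *)
Lemma integral_bernstein (R : realType) m (a : nat -> R) :
  oriented_integral 0 1
    (fun t => \sum_(0 <= k < m.+1) a k * (t ^+ (m - k) * (1 - t) ^+ k))
  = \sum_(0 <= k < m.+1) a k / (m.+1%:R * 'C(m, k)%:R).
Proof.
pose tail k : {poly R} := \sum_(m.+1 - k.+1 + 1 <= i < m.+2)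
  'C(m.+1, i)%:R *: ('X^i * (1 - 'X) ^+ (m.+1 - i)).
pose F := \sum_(0 <= k < m.+1) (a k / (k.+1%:R * 'C(m.+1, k.+1)%:R)) *: tail k.
transitivity (oriented_integral 0 1 (fun t => F^`().[t])).
  apply: eq_oriented_integral => t; rewrite /F raddf_sum horner_sum !big_nat.
  apply: eq_bigr => k /andP[_ km]; rewrite /= derivZ deriv_bernstein_tail//.
  rewrite scalerA mulfVK ?subSS; last by rewrite mulf_neq0// bin_neq0.
  by rewrite !hornerE.
rewrite oriented_integral_horner !horner_sum -sumrB !big_nat.
apply: eq_bigr => k /andP[_ km]; rewrite !hornerZ bernstein_tail0 ?addn1//.
rewrite bernstein_tail1; last by lia.
by rewrite mulr0 subr0 mulr1 -!natrM mul_bin_diag.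
Qed.

Section Signature.
Variables (R : realType) (n : nat) (p Pbar psi c : nat -> R) (g : {poly R}).
Hypothesis pE : forall k, (1 <= k <= n)%N -> p k = Pbar k.-1 - Pbar k.
Hypothesis Pbarn : Pbar n = 0.
Hypothesis psiE : forall k, (k <= n)%N -> psi k = 'C(n, k)%:R * Pbar (n - k)%N.
Hypothesis g_psi : g = \sum_(0 <= k < n.+1) psi k *: ('X^k * (1 - 'X) ^+ (n - k)).
Hypothesis g_c : g = \sum_(0 <= k < n.+1) c k *: 'X^k.

Let z (i : nat) : R := Pbar (n - i)%N.

Lemma g_bernstein : g = \sum_(0 <= k < n.+1)
   ('C(n, k)%:R * Pbar (n - k)%N) *: ('X^k * (1 - 'X) ^+ (n - k)).
Proof.
by rewrite g_psi !big_nat; apply: eq_bigr => k /andP[_ kn]; rewrite psiE.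
Qed.

(** The link between the monomial coefficients and the tail signature, from which
    the other relations are derived. *)
Lemma c_diff k : (k <= n)%N ->
  c k = 'C(n, k)%:R * iter k (@diff_op R) (fun i => Pbar (n - i)%N) 0%N.
Proof.
move=> kn; transitivity g`_k; first by rewrite g_c coef_sum_scaleX.
by rewrite g_bernstein bernstein_to_monomial coef_sum_scaleX.
Qed.

Lemma diff_c k : (k <= n)%N -> iter k (@diff_op R) z 0%N = c k / 'C(n, k)%:R.
Proof. by move=> kn; rewrite c_diff// mulrC mulKf// bin_neq0. Qed.

(** The bound on [i] matters: [p 0] is not an increment of [Pbar]. *)
Lemma p_diff i : (i < n)%N -> p (n - i)%N = diff_op z i.
Proof. by move=> lin; rewrite pE ?subnS /diff_op /z ?subnS//; lia. Qed.

Lemma iter_diff_p k : (0 < k <= n)%N ->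
  iter k.-1 (@diff_op R) (fun i => p (n - i)%N) 0%N = iter k (@diff_op R) z 0%N.
Proof.
move=> /andP[k0 kn]; rewrite -[in RHS](prednK k0) iterSr; apply: eq_iter_diff => j jk.
by rewrite p_diff//; lia.
Qed.

Lemma Pbar_c k : (k <= n)%N ->
  Pbar k = \sum_(0 <= j < (n - k).+1) 'C(n - k, j)%:R / 'C(n, j)%:R * c j.
Proof.
move=> kn; transitivity (z (n - k)%N); first by rewrite /z subKn.
rewrite newton_forward !big_nat; apply: eq_bigr => j /andP[_ jk].
by rewrite diff_c; [ring | lia].
Qed.

Lemma Pbar_c_ratio k : (k <= n)%N ->
  Pbar k = \sum_(0 <= j < (n - k).+1) 'C(n - j, k)%:R / 'C(n, k)%:R * c j.
Proof.
move=> kn; rewrite Pbar_c// !big_nat; apply: eq_bigr => j /andP[_ jk].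
by rewrite bin_ratio_swap//; lia.
Qed.

Lemma c_Pbar k : (k <= n)%N ->
  c k = 'C(n, k)%:R * \sum_(0 <= j < k.+1) (-1) ^+ (k - j) * 'C(k, j)%:R * Pbar (n - j)%N.
Proof. by move=> kn; rewrite c_diff// iter_diff. Qed.

Lemma psi_c k : (k <= n)%N ->
  psi k = \sum_(0 <= j < k.+1) 'C(n - j, k - j)%:R * c j.
Proof.
move=> kn; rewrite psiE// Pbar_c ?leq_subr// subKn// mulr_sumr !big_nat.
apply: eq_bigr => j /andP[_ jk].
by rewrite -(bin_ratio_trinomial R (k := k)) ?mulrA//; lia.
Qed.

Lemma c_psi k : (k <= n)%N ->
  c k = \sum_(0 <= j < k.+1) (-1) ^+ (k - j) * 'C(n - j, k - j)%:R * psi j.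
Proof.
move=> kn; rewrite c_Pbar// mulr_sumr !big_nat; apply: eq_bigr => j /andP[_ jk].
have jn : (j <= n)%N by lia.
rewrite psiE// -(bin_ratio_trinomial R (k := k)); last by lia.
by field; rewrite bin_neq0.
Qed.

Lemma p_c k : (0 < k <= n)%N ->
  p k = \sum_(0 <= j < (n - k).+1) 'C(n - k, j)%:R / 'C(n, j.+1)%:R * c j.+1.
Proof.
move=> /andP[k0 kn]; rewrite -[in LHS](subKn kn) p_diff; last by lia.
rewrite (newton_forward (diff_op z)) !big_nat; apply: eq_bigr => j /andP[_ jk].
by rewrite -iterSr diff_c; [ring | lia].
Qed.

Lemma p_c_ratio k : (0 < k <= n)%N ->
  p k = \sum_(0 <= j < (n - k).+1)
              'C(n - j, k)%:R / 'C(n, k)%:R * (j.+1%:R / (n - j)%:R) * c j.+1.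
Proof.
move=> /andP[k0 kn]; rewrite p_c ?k0// !big_nat; apply: eq_bigr => j /andP[_ jk].
by rewrite bin_ratio_next//; lia.
Qed.

(** Multiplication by ['X - 1] turns the coefficients into their decrements; the
    boundary terms are [Pbar 0 = 1] and [Pbar n = 0]. *)
Lemma generating_p : Pbar 0%N = 1 ->
  \sum_(1 <= k < n.+1) p k *: 'X^k
     = 1 + ('X - 1) * \sum_(0 <= k < n.+1) Pbar k *: 'X^k.
Proof.
move=> P0; pose up : {poly R} := \sum_(1 <= k < n.+1) Pbar k.-1 *: 'X^k.
pose low : {poly R} := \sum_(1 <= k < n.+1) Pbar k *: 'X^k.
have -> : \sum_(1 <= k < n.+1) p k *: 'X^k = up - low.
  rewrite -sumrB !big_nat; apply: eq_bigr => k kn.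
  by rewrite pE// scalerBl.
have SL : \sum_(0 <= k < n.+1) Pbar k *: 'X^k = 1 + low.
  by rewrite big_nat_recl//= P0 scale1r expr0 /low big_add1.
have -> : up = 'X * \sum_(0 <= k < n.+1) Pbar k *: 'X^k.
  rewrite big_nat_recr//= Pbarn scale0r addr0 /up big_add1/= mulr_sumr.
  by apply: eq_bigr => k _; rewrite -scalerAr -exprS.
by rewrite SL; ring.
Qed.

(** Summation by parts: consecutive tails differ by one Bernstein term, while
    [p] is the decrement of [Pbar]. *)
Lemma g_bernstein_tails : g = \sum_(1 <= k < n.+1)
   p k *: \sum_(n - k + 1 <= i < n.+1) 'C(n, i)%:R *: ('X^i * (1 - 'X) ^+ (n - i)).
Proof.
pose b i : {poly R} := 'C(n, i)%:R *: ('X^i * (1 - 'X) ^+ (n - i)).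
pose Q k : {poly R} := \sum_(n - k + 1 <= i < n.+1) b i.
(* Summation by parts up to [m]; the boundary term vanishes at [m = n]. *)
have abel m : (m <= n)%N -> \sum_(1 <= k < m.+1) p k *: Q k
    = \sum_(0 <= k < m) Pbar k *: b (n - k)%N - Pbar m *: Q m.
  elim: m => [_|m IH mn].
    by rewrite !big_geq// /Q subn0 big_geq ?addn1// scaler0 subrr.
  rewrite big_nat_recr//= IH 1?ltnW// pE// [in RHS]big_nat_recr//=.
  have -> : Q m.+1 = b (n - m)%N + Q m.
    rewrite {1}/Q (_ : n - m.+1 + 1 = n - m)%N; last by lia.
    by rewrite big_ltn ?ltnS ?leq_subr// /Q addn1.
  by rewrite scalerBl !scalerDr; ring.
rewrite abel// Pbarn scale0r subr0 g_bernstein big_nat_rev/= add0n.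
rewrite big_nat_recr//= subSS subnn subn0 Pbarn mulr0 scale0r addr0.
rewrite !big_nat; apply: eq_bigr => k /andP[_ kn].
by rewrite subSS subKn 1?ltnW// /b scalerA mulrC subKn// ltnW.
Qed.

Lemma deriv_g_bernstein : g^`() = \sum_(1 <= k < n.+1)
   (p k * k%:R * 'C(n, k)%:R) *: ('X^(n - k) * (1 - 'X) ^+ k.-1).
Proof.
rewrite g_bernstein_tails raddf_sum !big_nat; apply: eq_bigr => k kn.
by rewrite /= derivZ deriv_bernstein_tail// scalerA mulrA.
Qed.

Lemma reflect_g_shift :
  reflect_poly n g \Po ('X + 1) = \sum_(0 <= k < n.+1) ('C(n, k)%:R * Pbar k) *: 'X^k.
Proof.
rewrite g_bernstein reflect_shift_sum [RHS]big_nat_rev/= !big_nat.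
apply: eq_bigr => k /andP[_ kn].
rewrite reflect_bernstein_shift ?subnKC//.
by rewrite add0n subSS bin_sub.
Qed.

Lemma reflect_dg_shift : (0 < n)%N ->
  reflect_poly n.-1 g^`() \Po ('X + 1)
    = \sum_(0 <= k < n.-1.+1) (k.+1%:R * 'C(n, k.+1)%:R * p k.+1) *: 'X^k.
Proof.
move=> n0; rewrite deriv_g_bernstein big_add1/= prednK// reflect_shift_sum !big_nat.
apply: eq_bigr => k /andP[_ kn].
rewrite reflect_bernstein_shift; last by lia.
by congr (_ *: _); ring.
Qed.

Lemma integral_reflect_dg (x : R) : (0 < n)%N ->
  \sum_(1 <= k < n.+1) 'C(n, k)%:R * p k * x ^+ k
          = oriented_integral 0 x (fun t => (reflect_poly n.-1 g^`()).[t + 1]).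
Proof.
move=> n0; pose F : {poly R} := \sum_(1 <= k < n.+1) ('C(n, k)%:R * p k) *: 'X^k.
have F' : F^`() = reflect_poly n.-1 g^`() \Po ('X + 1).
  rewrite reflect_dg_shift// /F big_add1/= prednK// raddf_sum; apply: eq_bigr => k _.
  by rewrite /= derivZ derivXn -scalerMnr scalerMnl; congr (_ *: _); ring.
rewrite (@eq_oriented_integral _ _ _ _ (fun t => F^`().[t])); last first.
  by move=> t; rewrite F' horner_comp !hornerE.
rewrite oriented_integral_horner /F !horner_sum -sumrB !big_nat.
apply: eq_bigr => k /andP[k0 _].
by rewrite !hornerZ !hornerXn expr0n gtn_eqF// mulr0 subr0.
Qed.

Lemma generating_Pbar_integral (x : R) :
  \sum_(0 <= k < n.+1) Pbar k * x ^+ k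
    = oriented_integral 0 1 (fun t =>
        n.+1%:R * eval_tx (reflect_poly n (subst_tx (reflect_poly n g))) t x).
Proof.
rewrite (@eq_oriented_integral _ _ _ _ (fun t => \sum_(0 <= k < n.+1)
    (n.+1%:R * ('C(n, k)%:R * Pbar k * x ^+ k)) * (t ^+ (n - k) * (1 - t) ^+ k))).
  rewrite integral_bernstein !big_nat; apply: eq_bigr => k /andP[_ kn].
  by field; rewrite addrC natr1 bin_neq0 ?pnatr_eq0.
move=> t; rewrite (eval_reflect_subst _ _ reflect_g_shift) mulr_sumr.
by apply: eq_bigr => k _; ring.
Qed.

Lemma generating_p_integral (x : R) : (0 < n)%N ->
  \sum_(1 <= k < n.+1) p k * x ^+ k
    = oriented_integral 0 1 (fun t =>
        x * eval_tx (reflect_poly n.-1 (subst_tx (reflect_poly n.-1 g^`()))) t x).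
Proof.
move=> n0; rewrite (@eq_oriented_integral _ _ _ _ (fun t => \sum_(0 <= k < n.-1.+1)
    (x * (k.+1%:R * 'C(n, k.+1)%:R * p k.+1 * x ^+ k)) * (t ^+ (n.-1 - k) * (1 - t) ^+ k))).
  rewrite integral_bernstein prednK// big_add1/= !big_nat; apply: eq_bigr => k /andP[_ kn].
  have -> : n%:R * 'C(n.-1, k)%:R = k.+1%:R * 'C(n, k.+1)%:R :> R.
    by rewrite -!natrM mul_bin_diag.
  by rewrite exprS; field; rewrite addrC natr1 bin_neq0 ?pnatr_eq0.
move=> t; rewrite (eval_reflect_subst _ _ (reflect_dg_shift n0)) mulr_sumr.
by apply: eq_bigr => k _; ring.
Qed.

Lemma g_reg_beta (x : R) :
  g.[x] = \sum_(1 <= k < n.+1) p k * reg_beta x (n - k + 1) k.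
Proof.
rewrite g_bernstein_tails horner_sum !big_nat; apply: eq_bigr => k /andP[k0 kn].
rewrite hornerZ /reg_beta addn1/= -addn1 !beta_integral ?k0//.
rewrite bernstein_tail1; last by lia.
by rewrite mulr1 invrK mulrAC mulVf ?mul1r// mulf_neq0 ?bin_neq0// pnatr_eq0 -lt0n.
Qed.

Lemma g_xdiff (x : R) : g.[x] = iter n (xdiff_op x) (fun i => Pbar (n - i)%N) 0%N.
Proof.
rewrite iter_xdiff_bernstein g_bernstein horner_sum; apply: eq_bigr => k _.
by rewrite !hornerE /= ?add0n; ring.
Qed.

Lemma dg_xdiff (x : R) : (0 < n)%N ->
  g^`().[x] = n%:R * iter n.-1 (xdiff_op x) (fun i => p (n - i)%N) 0%N.
Proof.
move=> n0; rewrite iter_xdiff_bernstein deriv_g_bernstein big_add1/= prednK//.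
rewrite big_nat_rev/= add0n horner_sum mulr_sumr !big_nat; apply: eq_bigr => k /andP[_ kn].
rewrite !hornerE/= ?add0n subnSK// (_ : n - (n - k) = k)%N; last by lia.
rewrite (_ : n - k.+1 = n.-1 - k)%N; last by lia.
have : n%:R * 'C(n.-1, k)%:R = (n - k)%:R * 'C(n, n - k)%:R :> R.
  by rewrite -!natrM bin_sub 1?ltnW// mul_bin_down.
by move=> ->; ring.
Qed.
End Signature.

(** * Order patterns *)

Section OrderPattern.
Variables (R : realType) (n : nat).
Implicit Types (t : 'I_n -> R) (A B : {set 'I_n}).

Definition pattern := {ffun 'I_n * 'I_n -> bool}.

(** Non-strict comparisons make ties visible: [m (i, j)] and [m (j, i)] both hold.
    Hence the pattern determines, even in the presence of ties, which components
    realize a given order statistic. *)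
Definition order_pattern t : pattern := [ffun ij => t ij.1 <= t ij.2].

(** The components that fail strictly after [i]; [atleast] adds those that fail
    together with [i], including [i] itself. *)
Definition above (m : pattern) i : {set 'I_n} := [set j | ~~ m (j, i)]%SET.
Definition atleast (m : pattern) i : {set 'I_n} := [set j | m (i, j)]%SET.

(** The event whose probability is the relative quality of [A]. *)
Definition separates (m : pattern) A :=
  [forall i, forall j, (i \notin A) ==> (j \in A) ==> ~~ m (j, i)].

Lemma separatesP t A :
  reflect (forall i j, i \notin A -> j \in A -> t i < t j)
          (separates (order_pattern t) A).
Proof.
apply: (iffP forallP) => [sep i j iA jA|sep i].
  by have /forallP/(_ j) := sep i; rewrite iA jA !ffunE/= -ltNge.
by apply/forallP => j; apply/implyP => iA; apply/implyP => jA; rewrite ffunE/= -ltNge sep.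
Qed.

(** If [i] is in [A] but not in [B] and [j] in [B] but not in [A], then [t i] and
    [t j] are each smaller than the other.  In particular there is at most one
    separating set of each size. *)
Lemma separates_nested t A B :
  separates (order_pattern t) A -> separates (order_pattern t) B ->
  (#|A| <= #|B|)%N -> A \subset B.
Proof.
move=> /separatesP sA /separatesP sB AB; apply/negPn/negP => /fintype.subsetPn[i iA iB].
have BA : B \subset A.
  apply/fintype.subsetP => j jB; apply/negPn/negP => jA.
  by have := lt_trans (sA j i jA iA) (sB i j iB jB); rewrite ltxx.
suff /proper_card : B \proper A by rewrite ltnNge AB.
by apply/fintype.properP; split=> //; exists i.
Qed.

Lemma separates_above t i : separates (order_pattern t) (above (order_pattern t) i).
Proof.
apply/separatesP => j k; rewrite !inE !ffunE/= negbK -ltNge => ji ik.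
exact: le_lt_trans ik.
Qed.

Lemma separates_atleast t i :
  separates (order_pattern t) (atleast (order_pattern t) i).
Proof.
apply/separatesP => j k; rewrite !inE !ffunE/= -ltNge => ji ik.
exact: lt_le_trans ik.
Qed.

Definition tie_free (m : pattern) :=
  [forall i, forall j, (m (i, j) && m (j, i)) ==> (i == j)].

(** Component [i] realizes the [k]-th order statistic, [k] counted from 1. *)
Definition has_rank (m : pattern) k i :=
  (#|[set j | ~~ m (i, j)]%SET| < k <= #|[set j | m (j, i)]%SET|)%N.

(** Without ties the only component that fails together with [i] is [i]. *)
Lemma card_rank t k i : tie_free (order_pattern t) -> has_rank (order_pattern t) k i ->
  #|atleast (order_pattern t) i| = (n - k + 1)%N /\
  #|above (order_pattern t) i| = (n - k)%N.
Proof.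
set m := order_pattern t => /forallP/(_ i)/forallP tf.
have mii : m (i, i) by rewrite ffunE.
pose L : {set 'I_n} := [set j | ~~ m (i, j)]%SET.
have leE : [set j | m (j, i)]%SET = i |: L.
  apply/setP => j; rewrite !inE; have [->//|/negPf ji] := eqVneq j i.
  have := tf j; rewrite eq_sym ji /= implybF negb_and !ffunE/=.
  by case: ltgtP.
have iL : i \notin L by rewrite inE negbK.
rewrite /has_rank -/L leE cardsU1 iL /= add1n => rk.
have -> : atleast m i = ~: L by apply/setP => j; rewrite !inE negbK.
have -> : above m i = ~: (i |: L) by rewrite -leE; apply/setP => j; rewrite !inE.
have cardC (X : {set 'I_n}) : #|~: X| = (n - #|X|)%N by rewrite cardsCs finset.setCK card_ord.
have := max_card (i |: L); rewrite !cardC cardsU1 iL card_ord /= add1n. move: #|L| rk => l; lia.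
Qed.

(** Exactly one set of each size contributes. *)
Lemma sum_separates t U (F : {set 'I_n} -> R) : separates (order_pattern t) U ->
  \sum_(A : {set 'I_n} | #|A| == #|U|) (separates (order_pattern t) A)%:R * F A = F U.
Proof.
move=> sU; rewrite (bigD1 U)//= sU mul1r big1 ?addr0// => A /andP[/eqP AU].
case sA : (separates _ A); last by rewrite mul0r.
by rewrite finset.eqEsubset !(separates_nested _ _ (t := t)) ?AU.
Qed.
End OrderPattern.

(** * Probabilities of patterns *)

Section FiniteAdditivity.
Context {R : realType} {d : measure_display} {Omega : measurableType d}.
Variables (P : probability Omega R) (n : nat) (T : 'I_n -> {RV P >-> R}).

Let M (w : Omega) : pattern n := order_pattern (fun i => T i w).

Definition pattern_prob (m : pattern n) : R := fine (P [set w | M w = m]).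

Lemma measurable_pattern m : measurable [set w | M w = m].
Proof.
have -> : [set w | M w = m] =
    \bigcap_(ij in [set: 'I_n * 'I_n]) [set w | (T ij.1 w <= T ij.2 w) = m ij].
  apply/seteqP; split => w /= => [<- ij _|h]; first by rewrite /M ffunE.
  by apply/ffunP => ij; rewrite ffunE h.
apply: fin_bigcap_measurable => [|ij _]; first exact: finite_finset.
have := measurable_realfun.measurable_fun_ler (@measurable_funPT _ _ _ _ (T ij.1)) (@measurable_funPT _ _ _ _ (T ij.2)).
move=> /(_ measurableT [set m ij] I); rewrite setTI; exact.
Qed.

(** Partition of the sample space by the finitely many patterns.  This settles
    at once the measurability of all the events that are functions of the pattern,
    including those defined through sorting, and the additivity of their
    probabilities. *)
Lemma prob_patternE (f : pattern n -> bool) :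
  fine (P [set w | f (M w)]) = \sum_(m | f m) pattern_prob m.
Proof.
have -> : [set w | f (M w)] = \bigcup_(m in [set m | f m]) [set w | M w = m].
  apply/seteqP; split => w /=; first by move=> fM; exists (M w).
  by case=> m fm ->.
rewrite measure_fin_bigcup//; first last.
- by move=> m _; exact: measurable_pattern.
- by move=> m m' _ _ [w [/= <- <-]].
- exact: finite_finset.
rewrite (fsbigE (enum f)) ?enum_uniq//; first last.
- by move=> m /= fm; rewrite mem_enum => /negP; case.
- by move=> m /=; rewrite mem_enum.
rewrite -sum_fine; last by move=> m _; apply: fin_num_measure; exact: measurable_pattern.
rewrite big_enum_cond/=; apply: eq_bigl => m.
by rewrite mem_setE andbb.
Qed.
End FiniteAdditivity.

(** * The failure of the system *)

Section Events.
Context {R : realType} {d : measure_display} {Omega : measurableType d}.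
Variables (P : probability Omega R) (n : nat) (T : 'I_n -> {RV P >-> R}).

Let t (w : Omega) (i : 'I_n) : R := T i w.

Lemma lt_max_minE (A : {set 'I_n}) w :
  (max_lifetime T (~: A) w < min_lifetime T A w)%E
    = separates (order_pattern (t w)) A.
Proof.
apply/bigmax_ltP/separatesP => [[_ h] i j iA jA|h].
  have /bigmin_gtP[_ /(_ j jA)] : ((t w i)%:E < min_lifetime T A w)%E.
    by apply: h; rewrite inE.
  by rewrite lte_fin.
split=> [|i iA].
  by apply/bigmin_gtP; split=> // j _; rewrite ltNyr.
apply/bigmin_gtP; split=> [|j jA]; rewrite ?ltry// lte_fin h//.
by rewrite inE in iA.
Qed.

Variable phi : {ffun 'I_n -> bool} -> bool.
Hypothesis phi_sc : semicoherent phi.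

(** Monotonicity in each variable, applied to the components of [B :\: A] one
    after the other. *)
Lemma semicoherent_mono (A B : {set 'I_n}) : A \subset B -> path_set phi A -> path_set phi B.
Proof.
have [m] := ubnP #|B :\: A|; elim: m A B => // m IH A B mAB AB phiA.
have [BA|/fintype.subsetPn[i iB iA]] := boolP (B \subset A).
  by have -> : B = A by apply/eqP; rewrite finset.eqEsubset BA.
apply: (IH (i |: A) B).
- rewrite (cardsD1 i) !inE iA iB ltnS in mAB; apply: leq_trans mAB.
  by rewrite ltnS subset_leq_card//; apply/fintype.subsetP => j; rewrite !inE negb_or -andbA.
- by rewrite finset.subUset finset.sub1set iB.
case: phi_sc => mono _ _; change (is_true (phi (bvec A))) in phiA.
change (is_true (phi (bvec (i |: A)))).
have := mono i (bvec A) (bvec (i |: A)).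
rewrite phiA lt0b; apply=> [j /negPf ji|]; first by rewrite !ffunE !inE ji.
by rewrite !ffunE (negPf iA).
Qed.

(** The system is alive after time [a] iff the components alive after [a] contain
    a path set, hence form one by monotonicity. *)
Lemma lt_system_lifetime w (a : R) :
  (a%:E < system_lifetime T phi w)%E = path_set phi [set j | a < t w j]%SET.
Proof.
apply/bigmax_gtP/idP => [[//|[A phiA /bigmin_gtP[_ h]]]|phiA].
  apply: semicoherent_mono phiA; apply/fintype.subsetP => j /h.
  by rewrite lte_fin inE.
right; exists [set j | a < t w j]%SET => //.
by apply/bigmin_gtP; split=> [|j]; rewrite ?ltry// inE lte_fin.
Qed.

Lemma le_system_lifetime w (a : R) :
  (a%:E <= system_lifetime T phi w)%E = path_set phi [set j | a <= t w j]%SET.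
Proof.
apply/bigmax_geP/idP => [[//|[A phiA /bigmin_geP[_ h]]]|phiA].
  apply: semicoherent_mono phiA; apply/fintype.subsetP => j /h.
  by rewrite lee_fin inE.
right; exists [set j | a <= t w j]%SET => //.
by apply/bigmin_geP; split=> [|j]; rewrite ?leey// inE lee_fin.
Qed.

(** The lifetime equals [T i] iff it is at least, but not greater than, [T i]. *)
Lemma system_lifetime_eq w i :
  (system_lifetime T phi w == (t w i)%:E)
  = path_set phi (atleast (order_pattern (t w)) i)
    && ~~ path_set phi (above (order_pattern (t w)) i).
Proof.
have -> : atleast (order_pattern (t w)) i = [set j | t w i <= t w j]%SET.
  by apply/setP => j; rewrite !inE ffunE.
have -> : above (order_pattern (t w)) i = [set j | t w i < t w j]%SET.
  by apply/setP => j; rewrite !inE ffunE/= -ltNge.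
by rewrite -lt_system_lifetime -le_system_lifetime -leNgt eq_le andbC.
Qed.

Lemma order_stat_mem k w : (0 < k <= n)%N -> exists i, order_stat T k w = t w i.
Proof.
move=> kn; suff /mapP[i _ ->] : order_stat T k w \in [seq T i w | i <- enum 'I_n].
  by exists i.
rewrite -(mem_sort <=%R) mem_nth// size_sort size_map size_enum_ord; lia.
Qed.

Lemma order_statE k w i : (0 < k <= n)%N ->
  (order_stat T k w == t w i) = has_rank (order_pattern (t w)) k i.
Proof.
move=> kn; set s := sort <=%R [seq T i w | i <- enum 'I_n].
have srt : sorted <=%R s by exact: sort_le_sorted.
have countE (a : pred R) : count a s = #|[set j | a (t w j)]%SET|.
  rewrite (permP (permEl (perm_sort _ _))) count_map cardE -size_filter.
  rewrite enumT /enum_mem; congr size.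
  by apply: eq_filter => j; rewrite -[RHS]/(j \in [set j | a (t w j)]%SET) [RHS]inE.
have sz : size s = n by rewrite size_sort size_map size_enum_ord.
rewrite /has_rank.
have -> : [set j | ~~ order_pattern (t w) (i, j)]%SET = [set j | (< t w i)%R (t w j)]%SET.
  by apply/setP => j; rewrite !inE ffunE/= -ltNge.
have -> : [set j | order_pattern (t w) (j, i)]%SET = [set j | (<= t w i)%R (t w j)]%SET.
  by apply/setP => j; rewrite !inE ffunE/=.
rewrite -!countE; apply/eqP/idP => [E|h].
  apply/andP; split.
    rewrite ltnNge; apply/negP => lek.
    have := @nth_count_lt _ _ (t w i) 0 s k.-1 srt.
    rewrite -/(order_stat T k w) E ltxx => h; have // : false by apply: h; apply: leq_trans lek; lia.
  rewrite leqNgt; apply/negP => lek.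
  have := @nth_count_gt _ _ (t w i) 0 s k.-1 srt.
  rewrite -/(order_stat T k w) E ltxx => h; have // : false.
  apply: h; apply/andP; split; last by rewrite sz; lia.
  by apply: (leq_trans (n := k.-1)) => //; rewrite -ltnS prednK//; lia.
apply: nth_count_eq => //; case/andP: h => h1 h2; apply/andP; split.
  by rewrite -ltnS prednK//; lia.
by apply: leq_trans h2; lia.
Qed.

(** The system fails together with a component realizing the [k]-th order
    statistic, in terms of the pattern. *)
Definition fails_at (m : pattern n) k :=
  [exists i, [&& has_rank m k i, path_set phi (atleast m i) & ~~ path_set phi (above m i)]].

Lemma fails_atE k w : (0 < k <= n)%N ->
  (system_lifetime T phi w == (order_stat T k w)%:E) = fails_at (order_pattern (t w)) k.
Proof.
move=> kn; apply/idP/existsP => [|[i /and3P[]]].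
  have [i Ei] := order_stat_mem w kn.
  rewrite Ei system_lifetime_eq => h; exists i.
  by rewrite -order_statE// Ei eqxx.
by rewrite -order_statE// => /eqP -> h1 h2; rewrite system_lifetime_eq h1.
Qed.

(** A pointwise form of the signature formula: the two sums pick the survivors
    just before and just after the [k]-th failure, and the latter being a path set
    forces the former to be one. *)
Lemma fails_at_sum k w : (0 < k <= n)%N -> tie_free (order_pattern (t w)) ->
  (fails_at (order_pattern (t w)) k)%:R
  = \sum_(A : {set 'I_n} | #|A| == (n - k + 1)%N)
      (separates (order_pattern (t w)) A)%:R * (path_set phi A)%:R
  - \sum_(A : {set 'I_n} | #|A| == (n - k)%N)
      (separates (order_pattern (t w)) A)%:R * (path_set phi A)%:R :> R.
Proof.
move=> kn tf; have [i Ei] := order_stat_mem w kn.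
have rk : has_rank (order_pattern (t w)) k i by rewrite -order_statE// Ei.
(* The survivors just before and just after the [k]-th failure. *)
have [<- <-] := card_rank tf rk.
rewrite !sum_separates ?separates_above ?separates_atleast//.
rewrite -fails_atE// Ei system_lifetime_eq.
have sub : above (order_pattern (t w)) i \subset atleast (order_pattern (t w)) i.
  by apply/fintype.subsetP => j; rewrite !inE !ffunE/= -ltNge => /ltW.
have := semicoherent_mono sub.
case: (path_set phi (above _ _)) => [->//|_]; first by rewrite subrr.
by rewrite andbT subr0.
Qed.

Hypothesis nt : no_ties T.

Lemma pattern_prob_ge0 m : 0 <= pattern_prob T m.
Proof. by rewrite fine_ge0// measure_ge0. Qed.

(** Patterns with a tie have probability zero because each is contained in a null
    event [T i = T j]; the patterns realized by no sample point are empty events. *)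
Lemma pattern_prob_support m : pattern_prob T m != 0 ->
  exists2 w, m = order_pattern (t w) & tie_free m.
Proof.
move=> m0; have [w Mw] : exists w, order_pattern (t w) = m.
  apply: contra_notP (negP m0) => /forallNP h; rewrite /pattern_prob.
  by rewrite (_ : [set w | _] = set0) ?measure0// -subset0 => w /h.
exists w => //; apply/forallP => i; apply/forallP => j; apply/implyP => /andP[ij ji].
apply: contraNT m0 => ne_ij.
have := prob_patternE T (fun m => m (i, j) && m (j, i)).
have -> : [set w | order_pattern (fun i => T i w) (i, j)
               && order_pattern (fun i => T i w) (j, i)] = [set w | T i w = T j w].
  apply/seteqP; split=> v /=; rewrite !ffunE/=; first by move/le_anti.
  by move=> ->; rewrite lexx.
rewrite nt//= => /esym/psumr_eq0P -> //; first by move=> *; exact: pattern_prob_ge0.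
by rewrite ij.
Qed.

(** Both sides are expanded over the patterns and compared pattern by pattern. *)
Lemma prob_signature_psi k : (0 < k <= n)%N ->
  prob_signature T phi k
  = \sum_(A : {set 'I_n} | #|A| == (n - k + 1)%N) 'C(n, #|A|)%:R^-1 * q_structure T phi A
  - \sum_(A : {set 'I_n} | #|A| == (n - k)%N) 'C(n, #|A|)%:R^-1 * q_structure T phi A.
Proof.
move=> kn.
have q_psi l : \sum_(A : {set 'I_n} | #|A| == l) 'C(n, #|A|)%:R^-1 * q_structure T phi A
    = \sum_m pattern_prob T m * \sum_(A : {set 'I_n} | #|A| == l)
        (separates m A)%:R * (path_set phi A)%:R.
  under [RHS]eq_bigr do rewrite mulr_sumr.
  rewrite exchange_big; apply: eq_bigr => A _; rewrite /q_structure /rel_quality.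
  have An : (#|A| <= n)%N by rewrite -[X in (_ <= X)%N](card_ord n) max_card.
  rewrite -mulrA mulKf ?pnatr_eq0 -?lt0n ?bin_gt0//.
  under eq_set do rewrite lt_max_minE.
  rewrite (prob_patternE T (fun m => separates m A)) mulr_suml big_mkcond/=.
  by apply: eq_bigr => m _; case: ifP => _; rewrite ?mul1r// mul0r mulr0.
rewrite !q_psi -sumrB /prob_signature.
rewrite (_ : [set w | _] = [set w | fails_at (order_pattern (t w)) k]); last first.
  by apply/seteqP; split=> w /=; rewrite -fails_atE// => /eqP.
rewrite (prob_patternE T (fun m => fails_at m k)) big_mkcond; apply: eq_bigr => m _.
rewrite -mulrBr; have [->|/pattern_prob_support[w -> tf]] := eqVneq (pattern_prob T m) 0.
  by rewrite mul0r if_same.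
by rewrite -fails_at_sum//; case: ifP; rewrite ?mulr1 ?mulr0.
Qed.
End Events.

(** * The tail signature *)

Section TailSignature.
Context {R : realType} {d : measure_display} {Omega : measurableType d}.
Variables (P : probability Omega R) (n : nat) (T : 'I_n -> {RV P >-> R}).
Variable phi : {ffun 'I_n -> bool} -> bool.
Hypothesis phi_sc : semicoherent phi.
Hypothesis nt : no_ties T.

Lemma prob_signature_tail k : (0 < k <= n)%N ->
  prob_signature T phi k = tail_signature T phi k.-1 - tail_signature T phi k.
Proof.
move=> /andP[k0 kn]; rewrite /tail_signature prednK//.
by rewrite [X in _ = X - _]big_ltn ?ltnS// addrK.
Qed.

Lemma tail_signature_last : tail_signature T phi n = 0.
Proof. by rewrite /tail_signature big_geq. Qed.

Lemma level_sum_card (v : {set 'I_n} -> R) l :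
  \sum_(A : {set 'I_n} | #|A| == l) 'C(n, #|A|)%:R^-1 * v A
    = 'C(n, l)%:R^-1 * level_sum v l.
Proof. by rewrite /level_sum mulr_sumr; apply: eq_bigr => A /eqP ->. Qed.

Lemma level_sum_psi0 : level_sum (q_structure T phi) 0 = 0.
Proof.
apply: big1 => A /eqP/cards0_eq ->.
rewrite /q_structure (_ : Defs.set_fun phi (finset.set0 : {set 'I_n}) = false) ?mulr0//.
case: phi_sc => _ <- _; congr phi; apply/ffunP => i.
by rewrite !ffunE inE.
Qed.

(** Telescoping of [prob_signature_psi]; the last term is the one of the empty
    set, which is not a path set. *)
Lemma tail_signature_psi k : (k <= n)%N ->
  tail_signature T phi k = 'C(n, k)%:R^-1 * level_sum (q_structure T phi) (n - k)%N.
Proof.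
move=> kn; rewrite -(bin_sub kn) -level_sum_card.
pose S l := \sum_(A : {set 'I_n} | #|A| == l) 'C(n, #|A|)%:R^-1 * q_structure T phi A.
transitivity (\sum_(k <= i < n) (- S (n - i.+1)%N - - S (n - i)%N)).
  rewrite /tail_signature big_add1/= !big_nat; apply: eq_bigr => i /andP[_ lin].
  rewrite prob_signature_psi// opprK [RHS]addrC; congr (S _ - S _); lia.
rewrite (telescope_sumr (fun i => - S (n - i)%N))// subnn.
by rewrite {1}/S level_sum_card level_sum_psi0 mulr0 oppr0 sub0r opprK.
Qed.
End TailSignature.

Lemma q_structure_setT (R : realType) (d : measure_display) (Omega : measurableType d)
    (P : probability Omega R) (n : nat) (T : 'I_n -> {RV P >-> R}) phi :
  semicoherent phi -> q_structure T phi [set: 'I_n]%SET = 1.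
Proof.
case=> _ _ phi1; rewrite /q_structure cardsT card_ord binn mul1r /rel_quality.
rewrite (_ : Defs.set_fun _ _ = true); last first.
  by rewrite -phi1; congr phi; apply/ffunP => i; rewrite !ffunE inE.
rewrite (_ : [set w | _] = setT) ?probability_setT ?mulr1// -subTset => w _ /=.
by rewrite lt_max_minE; apply/separatesP => i j; rewrite inE.
Qed.

Lemma tail_signature0 (R : realType) (d : measure_display) (Omega : measurableType d)
    (P : probability Omega R) (n : nat) (T : 'I_n -> {RV P >-> R}) phi :
  semicoherent phi -> no_ties T -> tail_signature T phi 0 = 1.
Proof.
move=> sc nt; rewrite tail_signature_psi// bin0 invr1 mul1r subn0 /level_sum.
rewrite (big_pred1 [set: 'I_n]%SET) ?q_structure_setT// => A /=.
rewrite finset.eqEcard finset.subsetT cardsT card_ord eqn_leq.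
by rewrite -[X in (_ <= X)%N && _](card_ord n) max_card.
Qed.

(** * The equivalent descriptions of the signature *)

Theorem theorem10 (R : realType) (d : measure_display) (Omega : measurableType d)
    (P : probability Omega R) (n : nat) (phi : {ffun 'I_n -> bool} -> bool)
    (T : 'I_n -> {RV P >-> R}) :
  (1 <= n)%N -> semicoherent phi -> no_ties T ->
  let p : nat -> R := prob_signature T phi in
  let Pbar : nat -> R := tail_signature T phi in
  let psi : {set 'I_n} -> R := q_structure T phi in
  let G : mpoly n R := multilinear_ext psi in
  let c : {set 'I_n} -> R := multilinear_coef G in
  let g : {poly R} := diag_section G in
  let psi_ : nat -> R := level_sum psi in
  let c_ : nat -> R := level_sum c in
  (* (a) *)
  ((forall k : nat, (k <= n)%N -> Pbar k = \sum_(k.+1 <= i < n.+1) p i) /\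
   (forall k : nat, (1 <= k <= n)%N -> p k = Pbar k.-1 - Pbar k)) /\
  (* (b) *)
  (forall k : nat, (1 <= k <= n)%N ->
     p k = \sum_(A : {set 'I_n} | #|A| == (n - k + 1)%N) 'C(n, #|A|)%:R^-1 * psi A
         - \sum_(A : {set 'I_n} | #|A| == (n - k)%N) 'C(n, #|A|)%:R^-1 * psi A) /\
  (* (c) *)
  ((G = \sum_(A : {set 'I_n})
          psi A *: ((\prod_(i in A) mvar R i) * \prod_(i in ~: A) (1 - mvar R i)) /\
    G = \sum_(A : {set 'I_n}) c A *: \prod_(i in A) mvar R i) /\
   (g = \sum_(0 <= k < n.+1) psi_ k *: ('X^k * (1 - 'X) ^+ (n - k)) /\
    g = \sum_(0 <= k < n.+1) c_ k *: 'X^k)) /\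
  (* (d) *)
  (forall A : {set 'I_n},
     psi A = \sum_(B : {set 'I_n} | B \subset A) c B /\
     c A = \sum_(B : {set 'I_n} | B \subset A) (-1) ^+ (#|A| - #|B|) * psi B) /\
  (* (e) *)
  (forall k : nat, (1 <= k <= n)%N ->
     psi_ k = \sum_(0 <= j < k.+1) 'C(n - j, k - j)%:R * c_ j /\
     c_ k = \sum_(0 <= j < k.+1) (-1) ^+ (k - j) * 'C(n - j, k - j)%:R * psi_ j) /\
  (* (f) *)
  (\sum_(1 <= k < n.+1) p k *: 'X^k
     = 1 + ('X - 1) * \sum_(0 <= k < n.+1) Pbar k *: 'X^k) /\
  (* (g) *)
  (forall k : nat, (k <= n)%N ->
     Pbar k = 'C(n, k)%:R^-1 * \sum_(A : {set 'I_n} | #|A| == (n - k)%N) psi A /\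
     Pbar k = 'C(n, k)%:R^-1 * psi_ (n - k)%N) /\
  (* (h) *)
  ((forall k : nat, (k <= n)%N ->
      [/\ Pbar k = \sum_(0 <= j < (n - k).+1) 'C(n - j, k)%:R / 'C(n, k)%:R * c_ j,
          Pbar k = \sum_(0 <= j < (n - k).+1) 'C(n - k, j)%:R / 'C(n, j)%:R * c_ j &
          c_ k = 'C(n, k)%:R *
                   \sum_(0 <= j < k.+1) (-1) ^+ (k - j) * 'C(k, j)%:R * Pbar (n - j)%N]) /\
   (forall k : nat, (1 <= k <= n)%N ->
      c_ k = 'C(n, k)%:R * iter k (@diff_op R) (fun i => Pbar (n - i)%N) 0%N) /\
   (forall (z : nat -> R) (k i : nat),
      iter k (@diff_op R) z i
        = \sum_(0 <= j < k.+1) (-1) ^+ (k - j) * 'C(k, j)%:R * z (i + j)%N)) /\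
  (* (i) *)
  (forall k : nat, (1 <= k <= n)%N ->
     (p k = \sum_(0 <= j < (n - k).+1)
              'C(n - j, k)%:R / 'C(n, k)%:R * (j.+1%:R / (n - j)%:R) * c_ j.+1 /\
      p k = \sum_(1 <= j < (n - k + 1).+1) 'C(n - k, j.-1)%:R / 'C(n, j)%:R * c_ j) /\
     (c_ k = 'C(n, k)%:R *
               \sum_(0 <= j < k) (-1) ^+ (k.-1 - j) * 'C(k.-1, j)%:R * p (n - j)%N /\
      c_ k = 'C(n, k)%:R * iter k.-1 (@diff_op R) (fun i => p (n - i)%N) 0%N)) /\
  (* (j) *)
  [/\ g = \sum_(0 <= k < n.+1)
            (Pbar (n - k)%N * 'C(n, k)%:R) *: ('X^k * (1 - 'X) ^+ (n - k)),
      reflect_poly n g \Po ('X + 1)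
        = \sum_(0 <= k < n.+1) ('C(n, k)%:R * Pbar k) *: 'X^k &
      forall k : nat, (k <= n)%N ->
        'C(n, k)%:R * Pbar k = (reflect_poly n g \Po ('X + 1))`_k] /\
  (* (k) *)
  [/\ forall k : nat, (1 <= k <= n)%N ->
        k%:R * 'C(n, k)%:R * p k = (reflect_poly n.-1 g^`() \Po ('X + 1))`_k.-1,
      \sum_(1 <= k < n.+1) ('C(n, k)%:R * p k * k%:R) *: 'X^(k.-1)
        = reflect_poly n.-1 g^`() \Po ('X + 1) &
      forall x : R,
        \sum_(1 <= k < n.+1) 'C(n, k)%:R * p k * x ^+ k
          = oriented_integral 0 x (fun t => (reflect_poly n.-1 g^`()).[t + 1])] /\
  (* (l) *)
  [/\ forall x : R,
        \sum_(0 <= k < n.+1) Pbar k * x ^+ k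
          = oriented_integral 0 1 (fun t =>
              n.+1%:R * eval_tx (reflect_poly n (subst_tx (reflect_poly n g))) t x),
      forall x : R,
        \sum_(1 <= k < n.+1) p k * x ^+ k
          = oriented_integral 0 1 (fun t =>
              x * eval_tx (reflect_poly n.-1
                            (subst_tx (reflect_poly n.-1 g^`()))) t x) &
      forall k : nat, (k <= n)%N ->
        oriented_integral 0 1 (fun t : R => t ^+ (n - k) * (1 - t) ^+ k)
          = (n.+1%:R * 'C(n, k)%:R)^-1] /\
  (* (m) *)
  [/\ g^`() = \sum_(1 <= k < n.+1)
                (p k * k%:R * 'C(n, k)%:R) *: ('X^(n - k) * (1 - 'X) ^+ k.-1),
      forall x : R, 0 < x ->
        g.[x] = \sum_(1 <= k < n.+1) p k * reg_beta x (n - k + 1) k &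
      g = \sum_(1 <= k < n.+1)
            p k *: \sum_(n - k + 1 <= i < n.+1)
                     'C(n, i)%:R *: ('X^i * (1 - 'X) ^+ (n - i))] /\
  (* (n) *)
  (forall x : R,
     g.[x] = iter n (xdiff_op x) (fun i => Pbar (n - i)%N) 0%N /\
     g^`().[x] = n%:R * iter n.-1 (xdiff_op x) (fun i => p (n - i)%N) 0%N).
Proof.
move=> n1 sc nt p Pbar psi G c g psi_ c_.
have pE k : (0 < k <= n)%N -> p k = Pbar k.-1 - Pbar k.
  exact: prob_signature_tail.
have Pbarn : Pbar n = 0 by exact: tail_signature_last.
have P0 : Pbar 0%N = 1 by exact: tail_signature0.
have Pbar_psi k : (k <= n)%N -> Pbar k = 'C(n, k)%:R^-1 * psi_ (n - k)%N.
  exact: tail_signature_psi.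
have psiE k : (k <= n)%N -> psi_ k = 'C(n, k)%:R * Pbar (n - k)%N.
  by move=> kn; rewrite Pbar_psi ?leq_subr// subKn// bin_sub// mulVKf ?bin_neq0.
have g_psi : g = \sum_(0 <= k < n.+1) psi_ k *: ('X^k * (1 - 'X) ^+ (n - k)).
  exact: diag_section_psi.
have g_c : g = \sum_(0 <= k < n.+1) c_ k *: 'X^k by exact: diag_section_c.
split; first by split=> // k kn; exact: pE.
split; first by move=> k kn; exact: prob_signature_psi.
split; first by split; split=> //; exact: multilinear_ext_monomial.
split.
  move=> A; split; first exact: sum_multilinear_coef.
  exact: multilinear_coefE.
split.
  move=> k /andP[_ kn]; split; first exact: (psi_c psiE g_psi g_c).
  exact: (c_psi psiE g_psi g_c).
split; first exact: generating_p.
split; first by move=> k kn; split; exact: Pbar_psi.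
split.
  split; last split; last exact: iter_diff.
    move=> k kn; split; first exact: (Pbar_c_ratio psiE g_psi g_c).
      exact: (Pbar_c psiE g_psi g_c).
    exact: (c_Pbar psiE g_psi g_c).
  by move=> k /andP[_ kn]; exact: (c_diff psiE g_psi g_c).
split.
  move=> k kn; have /andP[k0 kn'] := kn.
  have c_iter : c_ k = 'C(n, k)%:R * iter k.-1 (@diff_op R) (fun i => p (n - i)%N) 0%N.
    by rewrite (iter_diff_p pE)// (c_diff psiE g_psi g_c).
  split; split=> //.
  - exact: (p_c_ratio pE psiE g_psi g_c).
  - by rewrite (p_c pE psiE g_psi g_c)// addn1 big_add1.
  - by rewrite c_iter iter_diff (prednK k0).
have g_refl := reflect_g_shift psiE g_psi.
have dg_refl := reflect_dg_shift pE Pbarn psiE g_psi n1.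
split.
  split=> [||k kn]; [ |exact: g_refl|by rewrite g_refl coef_sum_scaleX].
  rewrite (g_bernstein psiE g_psi); apply: eq_bigr => k _.
  by rewrite [X in X *: _]mulrC.
split.
  split=> [k /andP[k0 kn]| |x]; last exact: (integral_reflect_dg pE Pbarn psiE g_psi).
    by rewrite dg_refl coef_sum_scaleX ?prednK//; lia.
  rewrite dg_refl big_add1/= prednK//; apply: eq_bigr => k _.
  by rewrite mulrAC [X in X * _]mulrC.
split.
  split=> [x|x|k kn].
  - exact: (generating_Pbar_integral psiE g_psi).
  - exact: (generating_p_integral pE Pbarn psiE g_psi).
  - exact: beta_integral01.
split.
  split=> [|x _|].
  - exact: (deriv_g_bernstein pE Pbarn psiE g_psi).
  - exact: (g_reg_beta pE Pbarn psiE g_psi).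
  - exact: (g_bernstein_tails pE Pbarn psiE g_psi).
move=> x; split; first exact: (g_xdiff psiE g_psi).
exact: (dg_xdiff pE Pbarn psiE g_psi).
Qed.
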